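(* Let $k\ge 1$ be an integer and let $G$ be a graph on $n$ vertices with adjacency matrix $A$ having eigenvalues $\lambda_1\ge\lambda_2\ge\cdots\ge\lambda_n$ (listed with multiplicity). Then $$\alpha_k(G)\le \left|\{i\in\{1,\dots,n\}:\lambda_i^k\ge w_k(G)\}\right|\quad\text{and}\quad \alpha_k(G)\le \left|\{i\in\{1,\dots,n\}:\lambda_i^k\le W_k(G)\}\right|.$$
   Context: Graphs are finite, undirected, simple and loopless. The $k$-independence number $\alpha_k(G)$ is the maximum size of a set of vertices of $G$ that are pairwise at distance greater than $k$ (vertices in different connected components are at infinite distance). $w_k(G)=\min_i (A^k)_{ii}$ is the minimum, over all vertices $i$ of $G$, of the number of closed walks of length $k$ starting at $i$, and $W_k(G)=\max_i (A^k)_{ii}$ is the corresponding maximum. *)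

(* Defs.v *)
From HB Require Import structures.
From mathcomp Require Import all_boot all_order all_algebra.

Set Implicit Arguments.
Unset Strict Implicit.
Unset Printing Implicit Defensive.

Import Order.TTheory GRing.Theory Num.Theory.

Local Open Scope ring_scope.

(* A finite simple graph is a symmetric irreflexive relation [e] on a finType. *)

Section Distance.
Variables (T : finType) (e : rel T).

Definition has_walk (x y : T) (m : nat) : bool :=
  [exists p : m.-tuple T, path e x p && (last x p == y)].

Lemma connect_has_walk x y : connect e x y -> exists m, has_walk x y m.
Proof.
case/connectP=> p ep ->; exists (size p).
by apply/existsP; exists (in_tuple p); rewrite ep eqxx.
Qed.

(* [None] is the infinite distance. *)
Definition gdist (x y : T) : option nat :=
  match @idP (connect e x y) with
  | ReflectT exy => Some (ex_minn (connect_has_walk exy))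
  | ReflectF _ => None
  end.

Definition dist_gt (k : nat) (x y : T) : bool :=
  if gdist x y is Some d then (k < d)%N else true.

Lemma dist_gtP k x y :
  reflect (forall p, path e x p -> last x p = y -> (k < size p)%N)
          (dist_gt k x y).
Proof.
rewrite /dist_gt /gdist; case: {-}_ / idP => [exy|nexy]; last first.
  by apply: ReflectT => p ep yp; case: nexy; apply/connectP; exists p.
case: ex_minnP => d walk_d dmin; apply: (iffP idP) => [kd p ep yp|gt_k].
  apply: leq_trans kd (dmin _ _).
  by apply/existsP; exists (in_tuple p); rewrite ep yp eqxx.
by have /existsP[q /andP[eq /eqP yq]] := walk_d; rewrite -(size_tuple q) gt_k.
Qed.

Definition k_independent (k : nat) (S : {set T}) : bool :=
  [forall x in S, forall y in S, (x != y) ==> dist_gt k x y].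

Definition alpha (k : nat) : nat :=
  \max_(S : {set T} | k_independent k S) #|S|.

End Distance.

Section Walks.
Variables (R : rcfType) (T : finType) (e : rel T).

Definition adjacency : 'M[R]_#|T| :=
  \matrix_(i, j) (e (enum_val i) (enum_val j))%:R.

Definition closed_walk_counts (k : nat) : seq R :=
  [seq (adjacency ^+ k) i i | i : 'I_#|T|].

(* [head 0 s] only serves as a neutral starting element taken from the list
   itself; both numbers are 0 by convention on the empty graph. *)
Definition w_min (k : nat) : R :=
  let s := closed_walk_counts k in \big[Num.min/head 0 s]_(x <- s) x.

Definition W_max (k : nat) : R :=
  let s := closed_walk_counts k in \big[Num.max/head 0 s]_(x <- s) x.

Definition is_spectrum n (A : 'M[R]_n) (lam : n.-tuple R) : Prop :=
  sorted >=%R lam /\ char_poly A = \prod_(x <- lam) ('X - x%:P).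

End Walks.

(* Main.v *)
(** For a k-independent set S, the matrix A^k restricted to S is diagonal, since
    a nonzero entry (A^k)_{uv} yields a walk of length k from u to v.  So on the
    coordinate subspace of S the quadratic form of A^k is at least w_k times the
    squared norm, whereas it is strictly smaller on nonzero vectors of the span
    of the eigenvectors with lambda^k < w_k.  The two subspaces meet trivially,
    and counting dimensions gives the first bound; the second is the same
    argument for -A^k and -W_k.  Real symmetric matrices are diagonalized over
    R[i], where the spectral theorem is available. *)
Require Import Defs.
From HB Require Import structures.
From mathcomp Require Import all_boot all_order all_fingroup all_algebra complex.

Set Implicit Arguments.
Unset Strict Implicit.
Unset Printing Implicit Defensive.

Import Order.TTheory GRing.Theory Num.Theory.

Local Open Scope ring_scope.
Local Open Scope sesquilinear_scope.

Lemma diag_form_entry (C : numClosedFieldType) m n (d : 'rV[C]_n)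
    (x : 'M[C]_(m, n)) i :
  (x *m diag_mx d *m x^t*) i i = \sum_j d 0 j * `|x i j| ^+ 2.
Proof.
rewrite !mxE; apply: eq_bigr => j _.
by rewrite mul_mx_diag !mxE normCK mulrAC mulrC mulrA.
Qed.

Lemma ex_nonzero_ker_row (F : fieldType) m n (M : 'M[F]_(m, n)) :
  (n < m)%N -> exists2 y : 'rV[F]_m, y != 0 & y *m M = 0.
Proof.
move=> lt_nm; have /rowV0Pn[y /sub_kermxP yM y0] : kermx M != 0; last by exists y.
rewrite -mxrank_eq0 mxrank_ker subn_eq0 -ltnNge.
exact: leq_ltn_trans (rank_leq_col M) lt_nm.
Qed.

(** Taking a matrix through an arbitrary unitary diagonalization with real eigenvalues lets one
    argument serve both for [A^k] and for its negative. *)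
Lemma card_le_spectrum_ge (C : numClosedFieldType) n (P : 'M[C]_n)
    (d : 'rV[C]_n) (w : C) (S : {set 'I_n}) :
  let B := P^t* *m diag_mx d *m P in
  P \is unitarymx -> w \is Num.real -> (forall j, d 0 j \is Num.real) ->
  {in S &, forall i j, i != j -> B i j = 0} -> {in S, forall i, w <= B i i} ->
  (#|S| <= #|[set j | (w <= d 0 j)%R]|)%N.
Proof.
move=> B Pu w_real d_real B_off B_diag; rewrite leqNgt; apply/negP.
set J := [set j | _] => lt_JS.
(* Right multiplication by [E] extends a row vector on [S] by zero; by [F], it keeps only the
   coordinates in [J]. *)
pose E : 'M[C]_(#|S|, n) := rowsub enum_val 1%:M.
pose F : 'M[C]_(n, #|J|) := colsub enum_val 1%:M.
(* y is a combination of the coordinate vectors of S that is orthogonal to the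
   eigenvectors indexed by J; z is its vector of eigencoordinates. *)
have [y y0 yM] := ex_nonzero_ker_row (E *m P^t* *m F) lt_JS.
pose z := y *m E *m P^t*.
have zJ j : j \in J -> z 0 j = 0.
  move=> jJ; move/rowP/(_ (enum_rank_in jJ j)): yM.
  rewrite !mulmxA -/z mulmx_colsub mulmx1 !mxE.
  by rewrite enum_rankK_in.
have E_unit : E *m E^t* = 1%:M.
  apply/matrixP => s t; rewrite !mxE (bigD1 (enum_val t)) //= big1 ?addr0 => [|i it].
    by rewrite !mxE eqxx conjC1 mulr1 (inj_eq enum_val_inj).
  by rewrite !mxE [enum_val t == i]eq_sym (negPf it) conjC0 mulr0.
have BE : E *m B *m E^t* = diag_mx (\row_s B (enum_val s) (enum_val s)).
  have -> : E^t* = colsub enum_val 1%:M.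
    by apply/matrixP => i j; rewrite !mxE conjC_nat eq_sym.
  rewrite mulmx_colsub mulmx1 mul_rowsub_mx mul1mx.
  apply/matrixP => s t; rewrite 2![LHS]mxE [RHS]mxE [X in X *+ _]mxE.
  have [-> //|st] := eqVneq s t.
  by rewrite B_off ?enum_valP ?(inj_eq enum_val_inj).
have zz : z *m z^t* = y *m y^t*.
  rewrite /z !trmx_mul !map_mxM /= trmxCK !mulmxA mulmxKtV //.
  by rewrite -[y *m E *m _]mulmxA E_unit mulmx1.
have zdz : z *m diag_mx d *m z^t* = y *m (E *m B *m E^t*) *m y^t*.
  by rewrite /z /B !trmx_mul !map_mxM /= trmxCK !mulmxA.
(* Back in the original coordinates, this sum is the form of [E B E^*] at [y] minus [w] times the
   squared norm of [y], and [E B E^*] is diagonal with entries at least [w]. *)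
have sum_ge0 : \sum_j (d 0 j - w) * `|z 0 j| ^+ 2 >= 0.
  have -> : \sum_j (d 0 j - w) * `|z 0 j| ^+ 2 =
     (z *m diag_mx d *m z^t*) 0 0 - (z *m diag_mx (const_mx w) *m z^t*) 0 0.
    rewrite !diag_form_entry -sumrB; apply: eq_bigr => j _.
    by rewrite [const_mx _ _ _]mxE mulrBl.
  rewrite subr_ge0 diag_const_mx mul_mx_scalar -scalemxAl zz zdz BE.
  rewrite scalemxAl -mul_mx_scalar -diag_const_mx !diag_form_entry.
  apply: ler_sum => s _; rewrite [X in X * _]mxE [X in _ <= X * _]mxE.
  rewrite ler_wpM2r ?exprn_ge0 //.
  by rewrite B_diag ?enum_valP.
have term_le0 j : (d 0 j - w) * `|z 0 j| ^+ 2 <= 0.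
  have [jJ|] := boolP (j \in J); first by rewrite zJ // normr0 expr0n mulr0.
  rewrite inE -real_ltNge // => /ltW dw.
  by rewrite mulr_le0_ge0 ?exprn_ge0 // subr_le0.
(* A nonnegative sum of nonpositive terms has only zero terms; outside [J] the factor [d 0 j - w] is
   negative, so [z 0 j] must vanish. *)
have z0 : z = 0.
  apply/rowP => j; rewrite [RHS]mxE.
  have [/zJ //|] := boolP (j \in J); rewrite inE -real_ltNge // => dw.
  have /eqP : \sum_j - ((d 0 j - w) * `|z 0 j| ^+ 2) = 0.
    apply/le_anti; rewrite sumrN oppr_le0 sum_ge0 /= oppr_ge0.
    by apply: sumr_le0 => ? _.
  rewrite psumr_eq0 => [/allP/(_ j)|? _]; last by rewrite oppr_ge0.
  rewrite mem_index_enum oppr_eq0 mulf_eq0 subr_eq0 (lt_eqF dw) /= => /(_ isT).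
  by rewrite expf_eq0 normr_eq0 => /eqP.
case/eqP: y0; move/(congr1 (mulmx^~ (P *m E^t*))): z0.
by rewrite /z /= mul0mx mulmxA mulmxKtV // -mulmxA E_unit mulmx1.
Qed.

Lemma char_poly_conjVmx (F : fieldType) n (P A : 'M[F]_n) :
  P \in unitmx -> char_poly (invmx P *m A *m P) = char_poly A.
Proof.
move=> Pu; rewrite /char_poly /char_poly_mx !map_mxM /=.
set Q := map_mx _ P; set Q' := map_mx _ (invmx P).
have QQ : Q' *m Q = 1%:M by rewrite -map_mxM mulVmx // map_mx1.
have -> : 'X%:M - Q' *m map_mx polyC A *m Q =
    Q' *m ('X%:M - map_mx polyC A) *m Q.
  by rewrite mulmxBr mulmxBl mul_mx_scalar -scalemxAl QQ scalemx1.
by rewrite !det_mulmx mulrAC -det_mulmx QQ det1 mul1r.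
Qed.

(** The spectral theorem gives eigenvalues in an uncontrolled order; comparing the two
    factorizations of the characteristic polynomial yields a permutation matching them to [lam]. *)
Lemma realsym_spectral (R : rcfType) n (A : 'M[R]_n) (lam : n.-tuple R) :
  A^T = A -> char_poly A = \prod_(x <- lam) ('X - x%:P) ->
  exists2 P : 'M[R[i]]_n, P \is unitarymx &
    forall m, map_mx (real_complex R) (A ^+ m) =
       P^t* *m diag_mx (\row_j real_complex R (tnth lam j ^+ m)) *m P.
Proof.
move=> A_sym A_char; set Ac := map_mx (real_complex R) A.
have Ac_herm : Ac \is hermsymmx.
  apply/is_hermitianmxP; rewrite expr0 scale1r; apply/matrixP => i j.
  by rewrite !mxE conj_Creal ?complex_real ?eqxx // -[in LHS]A_sym mxE.
have [Q Qu [D QD]] : exists2 Q : 'M[R[i]]_n, Q \is unitarymx &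
    exists D, Ac = Q^t* *m diag_mx D *m Q.
  exists (spectralmx Ac); first exact: spectral_unitarymx.
  exists (spectral_diag Ac); rewrite -invmx_unitary ?spectral_unitarymx //.
  by apply/orthomx_spectralP/hermitian_normalmx.
have : char_poly Ac = \prod_(x <- [tuple D 0 j | j < n]) ('X - x%:P).
  rewrite QD -invmx_unitary // char_poly_conjVmx ?unitarymx_unit //.
  rewrite char_poly_trig ?diag_mx_is_trig // big_map big_enum /=.
  by apply: eq_bigr => j _; rewrite mxE eqxx.
rewrite -map_char_poly A_char rmorph_prod /=.
under eq_bigr do rewrite map_polyXsubC.
rewrite -(big_map (real_complex R) xpredT (fun x => 'X - x%:P)) => /prod_XsubC_eq.
move/(@tuple_permP _ _ _ [tuple D 0 j | j < n]) => [s lamE].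
have {}lamE j : real_complex R (tnth lam j) = D 0 (s j).
  have : tnth (map_tuple (real_complex R) lam) j =
         tnth [tuple tnth [tuple D 0 j | j < n] (s i) | i < n] j.
    by congr tnth; apply: val_inj.
  by rewrite tnth_map !tnth_mktuple.
(* Row [j] becomes row [s j] of [Q], which belongs to the eigenvalue [D 0 (s j)], that is [lam] at
   [j]. *)
exists (row_perm s Q).
  apply/row_unitarymxP => i j; rewrite !row_permEsub !row_rowsub.
  by rewrite (row_unitarymxP _) // (inj_eq perm_inj).
have AcX m : map_mx (real_complex R) (A ^+ m) =
    Q^t* *m diag_mx (\row_j D 0 j ^+ m) *m Q.
  elim: m => [|m IHm].
    rewrite expr0 map_mx1.
    rewrite (_ : diag_mx _ = 1%:M) ?mulmx1
            -?invmx_unitary ?mulVmx ?unitarymx_unit //.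
    by apply/matrixP=> i j; rewrite !mxE expr0.
  rewrite exprS map_mxM -/Ac IHm {1}QD !mulmxA mulmxtVK //.
  rewrite -[_ *m diag_mx _ *m diag_mx _]mulmxA mulmx_diag.
  by under eq_mx do rewrite mxE -exprS.
move=> m; rewrite AcX; apply/matrixP => i j.
rewrite !mxE (reindex_perm s); apply: eq_bigr => l _.
by rewrite !mul_mx_diag !mxE rmorphXn /= lamE.
Qed.

Lemma adjacency_sym (R : rcfType) (T : finType) (e : rel T) :
  symmetric e -> (adjacency R e)^T = adjacency R e.
Proof. by move=> e_sym; apply/matrixP => i j; rewrite !mxE e_sym. Qed.

Lemma adjacency_exp_eq0 (R : rcfType) (T : finType) (e : rel T) k i j :
  dist_gt e k (enum_val i) (enum_val j) -> (adjacency R e ^+ k) i j = 0.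
Proof.
move=> /dist_gtP far.
(* Excluding only walks of length exactly [k] suits the induction: prepending an edge to a walk of
   length [k] gives one of length [k + 1]. *)
have {far}: forall p, path e (enum_val i) p -> last (enum_val i) p = enum_val j ->
  size p != k.
  by move=> p ep pj; rewrite gtn_eqF // far.
elim: k i => [|k IHk] i nowalk.
  rewrite expr0 mxE; case: eqVneq => // ij.
  by have := nowalk [::] isT (congr1 _ ij).
rewrite exprS mxE big1 // => l _; rewrite mxE.
case e_il: (e _ _); last by rewrite mul0r.
rewrite IHk ?mulr0 // => p ep pj.
by have := nowalk (enum_val l :: p); rewrite /= e_il ep eqSS; apply.
Qed.

Lemma adjacency_exp_indep (R : rcfType) (T : finType) (e : rel T) k (S : {set T}) :
  k_independent e k S ->
  {in enum_val @^-1: S &, forall i j, i != j -> (adjacency R e ^+ k) i j = 0}.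
Proof.
move=> S_ind i j; rewrite !inE => iS jS ij; apply: adjacency_exp_eq0.
move/forall_inP/(_ _ iS)/forall_inP/(_ _ jS)/implyP: S_ind; apply.
by rewrite (inj_eq enum_val_inj).
Qed.

Lemma w_min_le (R : rcfType) (T : finType) (e : rel T) k i :
  w_min R e k <= (adjacency R e ^+ k) i i.
Proof. by apply: (ge_bigmin_seq _ _ xpredT id) => //; apply: image_f. Qed.

Lemma le_W_max (R : rcfType) (T : finType) (e : rel T) k i :
  (adjacency R e ^+ k) i i <= W_max R e k.
Proof. by apply: (le_bigmax_seq _ _ xpredT id) => //; apply: image_f. Qed.

Theorem theorem3p2 (R : rcfType) (T : finType) (e : rel T)
    (e_sym : symmetric e) (e_irr : irreflexive e)
    (k : nat) (k_ge1 : (1 <= k)%N)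
    (lam : #|T|.-tuple R) (lam_spec : is_spectrum (adjacency R e) lam) :
  (alpha e k <= #|[set i : 'I_#|T| | (w_min R e k <= tnth lam i ^+ k)%R]|)%N /\
  (alpha e k <= #|[set i : 'I_#|T| | (tnth lam i ^+ k <= W_max R e k)%R]|)%N.
Proof.
have [_ A_char] := lam_spec.
have [P Pu /(_ k) AkE] := realsym_spectral (adjacency_sym R e_sym) A_char.
set d := (\row_j _) in AkE.
have S_bound S : k_independent e k S ->
    (#|S| <= #|[set i | (w_min R e k <= tnth lam i ^+ k)%R]|)%N /\
    (#|S| <= #|[set i | (tnth lam i ^+ k <= W_max R e k)%R]|)%N.
  move=> /adjacency_exp_indep Ak_off.
  (* Matrices are indexed by ordinals, so [S] is replaced by its preimage under the bijection
     [enum_val]. *)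
  rewrite -(on_card_preimset (onW_bij _ (enum_val_bij T))); split.
  - have := @card_le_spectrum_ge _ _ P d (w_min R e k)%:C%C
      (enum_val @^-1: S) Pu.
    rewrite -AkE; under eq_finset do rewrite mxE lecR; apply.
    + by rewrite complex_real.
    + by move=> j; rewrite mxE complex_real.
    + by move=> i j iS jS ij; rewrite mxE Ak_off.
    + by move=> i _; rewrite mxE lecR w_min_le.
  (* Negating the matrix and the threshold turns the upper bound [W_max] on diagonal entries into a
     lower bound, with the same [P]. *)
  - have := @card_le_spectrum_ge _ _ P (- d) (- (W_max R e k))%:C%C
      (enum_val @^-1: S) Pu.
    rewrite [diag_mx (- d)]raddfN mulmxN mulNmx -AkE.
    under eq_finset do rewrite !mxE -rmorphN lecR lerN2; apply.
    + by rewrite complex_real.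
    + by move=> j; rewrite !mxE rpredN complex_real.
    + by move=> i j iS jS ij; rewrite !mxE Ak_off // oppr0.
    + by move=> i _; rewrite !mxE -rmorphN lecR lerN2 le_W_max.
by split; apply/bigmax_leqP => S /S_bound[].
Qed.
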